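(* $(\ell^p, \gamma)$ is the initial object of $\mathscr{D}^p$ for $1 \leq p < \infty$, and $(c_0, \gamma)$ is the initial object of $\mathscr{D}^\infty$.
   Context: $\mathbb{F}$ is a fixed field, either $\mathbb{R}$ or $\mathbb{C}$. Maps of Banach spaces are linear contractions (linear maps of norm $\le 1$). For $p \in [1,\infty]$ and Banach spaces $V, W$ over $\mathbb{F}$, $V \boxplus_p W$ denotes the direct sum $V \oplus W$ with norm $\|(v,w)\| = (\|v\|^p + \|w\|^p)^{1/p}$ if $p < \infty$ and $\|(v,w)\| = \max\{\|v\|, \|w\|\}$ if $p = \infty$. $\mathscr{D}^p$ is the category whose objects are pairs $(V, \delta)$ with $V$ a Banach space and $\delta \colon \mathbb{F} \boxplus_p V \to V$ a linear contraction. A map $(V', \delta') \to (V, \delta)$ in $\mathscr{D}^p$ is a linear contraction $\theta \colon V' \to V$ such that $\theta \circ \delta' = \delta \circ (\mathrm{id}_{\mathbb{F}} \oplus \theta)$. $\ell^p$ is the usual Banach space of $p$-summable sequences $(a_0, a_1, \ldots)$ in $\mathbb{F}$, and $c_0$ is the Banach space of sequences in $\mathbb{F}$ converging to $0$, with the sup norm. The maps $\gamma \colon \mathbb{F} \boxplus_p \ell^p \to \ell^p$ and $\gamma \colon \mathbb{F} \boxplus_\infty c_0 \to c_0$ are both defined by $\gamma(a, (a_0, a_1, \ldots)) = (a, a_0, a_1, \ldots)$. *)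

(* Defs.v *)
From Stdlib Require Import Reals Lra Lia ProofIrrelevance FunctionalExtensionality.
From Stdlib Require Import PropExtensionality ClassicalEpsilon.
From Coquelicot Require Import Coquelicot.

Open Scope R_scope.

(* [Rpower 0 p] is [1] in Stdlib (because [ln 0 = 0]), so it cannot be used
   directly for the norms [(sum_n |a_n|^p)^(1/p)]. *)
Definition Rpow (x p : R) : R := if Req_dec_T x 0 then 0 else Rpower x p.

Lemma Rpow_0 p : Rpow 0 p = 0.
Proof. unfold Rpow; destruct (Req_dec_T 0 0); lra. Qed.

Lemma Rpow_pos x p : 0 < x -> Rpow x p = Rpower x p.
Proof. intros H; unfold Rpow; destruct (Req_dec_T x 0); lra. Qed.

Lemma Rpow_gt0 x p : 0 < x -> 0 < Rpow x p.
Proof. intros H; rewrite Rpow_pos; [apply exp_pos | easy]. Qed.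

Lemma Rpow_ge0 x p : 0 <= Rpow x p.
Proof.
unfold Rpow; destruct (Req_dec_T x 0); [lra | left; apply exp_pos].
Qed.

Lemma Rpow_le x y p : 0 <= p -> 0 <= x <= y -> Rpow x p <= Rpow y p.
Proof.
intros Hp [[Hx | <-] Hxy].
- rewrite !Rpow_pos by lra; apply Rle_Rpower_l; lra.
- rewrite Rpow_0; apply Rpow_ge0.
Qed.

Lemma Rpow_mult x y p : 0 <= x -> 0 <= y -> Rpow (x * y) p = Rpow x p * Rpow y p.
Proof.
intros [Hx | <-] [Hy | <-]; rewrite ?Rmult_0_l, ?Rmult_0_r, ?Rpow_0; try ring.
rewrite !Rpow_pos; try easy.
- symmetry; apply Rpower_mult_distr; easy.
- apply Rmult_lt_0_compat; easy.
Qed.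

Lemma Rpow_Rpow_inv x p : 0 < p -> 0 <= x -> Rpow (Rpow x p) (/ p) = x.
Proof.
intros Hp [Hx | <-]; [| rewrite !Rpow_0; easy].
rewrite (Rpow_pos (Rpow x p)) by (apply Rpow_gt0; easy).
rewrite Rpow_pos by easy.
rewrite Rpower_mult, Rinv_r, Rpower_1; lra.
Qed.

Lemma Rpow_inv_Rpow x p : 0 < p -> 0 <= x -> Rpow (Rpow x (/ p)) p = x.
Proof.
intros Hp Hx; rewrite <- (Rinv_inv p) at 2.
apply Rpow_Rpow_inv; [apply Rinv_0_lt_compat | ]; easy.
Qed.

Lemma Rpow_inv_le x y p :
  0 < p -> 0 <= x -> 0 <= y -> (Rpow x (/ p) <= y <-> x <= Rpow y p).
Proof.
intros Hp Hx Hy; pose proof (Rinv_0_lt_compat _ Hp); split; intros H1.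
- rewrite <- (Rpow_inv_Rpow x p) by easy.
  apply Rpow_le; [lra | split; [apply Rpow_ge0 | easy]].
- rewrite <- (Rpow_Rpow_inv y p) by easy.
  apply Rpow_le; lra.
Qed.

Lemma Rpow_tangent z p : 1 <= p -> 0 <= z -> 1 + p * (z - 1) <= Rpow z p.
Proof.
intros Hp [Hz | <-]; [| rewrite Rpow_0; nra].
rewrite Rpow_pos by easy.
pose (f := fun x => Rpower x p - p * x).
assert (Hd : forall c, 0 < c ->
  is_derive f c (p * Rpower c (p - 1) - p)).
{ intros c Hc; unfold f.
  apply (is_derive_minus (K := R_AbsRing) (V := R_NormedModule)
    (fun x => Rpower x p) (fun x => p * x) c (p * Rpower c (p - 1)) p).
  - apply is_derive_Reals, derivable_pt_lim_power; easy.
  - auto_derive; [easy | ring]. }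
assert (H1 : Rpower 1 p = 1) by (unfold Rpower; rewrite ln_1, Rmult_0_r, exp_0; easy).
destruct (MVT_gen f 1 z (fun c => p * Rpower c (p - 1) - p)) as [c [Hc Heq]].
- intros c Hc; apply Hd; revert Hc; unfold Rmin; destruct Rle_dec; lra.
- intros c Hc; apply continuity_pt_filterlim.
  apply (ex_derive_continuous (K := R_AbsRing) (V := R_NormedModule)).
  eexists; apply Hd.
  revert Hc; unfold Rmin; destruct Rle_dec; lra.
- enough (0 <= (p * Rpower c (p - 1) - p) * (z - 1)) by (unfold f in Heq; lra).
  revert Hc; unfold Rmin, Rmax; destruct Rle_dec as [Hle | Hle]; intros Hc.
  + assert (1 <= Rpower c (p - 1)).
    2:{ replace (p * Rpower c (p - 1) - p) with (p * (Rpower c (p - 1) - 1)) by ring.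
        apply Rmult_le_pos; [apply Rmult_le_pos |]; lra. }
    rewrite <- (Rpower_O c) at 1 by lra; apply Rle_Rpower; lra.
  + assert (Rpower c (p - 1) <= 1).
    { replace 1 with (Rpower 1 (p - 1)) at 2
        by (unfold Rpower; rewrite ln_1, Rmult_0_r, exp_0; easy).
      apply Rle_Rpower_l; lra. }
    replace ((p * Rpower c (p - 1) - p) * (z - 1))
      with (p * (1 - Rpower c (p - 1)) * (1 - z)) by ring.
    apply Rmult_le_pos; [apply Rmult_le_pos |]; lra.
Qed.

Lemma Rpow_convex s t l p : 1 <= p -> 0 <= s -> 0 <= t -> 0 <= l <= 1 ->
  Rpow (l * s + (1 - l) * t) p <= l * Rpow s p + (1 - l) * Rpow t p.
Proof.
intros Hp Hs Ht Hl.
pose proof (Rpow_ge0 s p); pose proof (Rpow_ge0 t p).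
set (m := l * s + (1 - l) * t).
assert (Hm : 0 <= m) by (unfold m; nra).
destruct Hm as [Hm | Hm]; [| rewrite <- Hm, Rpow_0; nra].
assert (K : forall x, 0 <= x -> Rpow m p * (1 + p * (x / m - 1)) <= Rpow x p).
{ intros x Hx.
  assert (0 <= x / m) by (apply Rdiv_le_0_compat; easy).
  replace x with (m * (x / m)) at 2 by (field; lra).
  rewrite Rpow_mult by lra.
  apply Rmult_le_compat_l; [apply Rpow_ge0 | apply Rpow_tangent; easy]. }
pose proof (K s Hs) as Ks; pose proof (K t Ht) as Kt.
apply Rle_trans with (l * (Rpow m p * (1 + p * (s / m - 1)))
   + (1 - l) * (Rpow m p * (1 + p * (t / m - 1)))).
- right.
  transitivity (Rpow m p * (1 + p * ((l * s + (1 - l) * t) / m - 1))).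
  + fold m; field; lra.
  + field; lra.
- apply Rplus_le_compat; apply Rmult_le_compat_l; lra.
Qed.

Lemma Rpow_plus_le x y A B p : 1 <= p -> 0 <= x -> 0 <= y -> 0 < A -> 0 < B ->
  Rpow (x + y) p <=
  Rpow (A + B) p * (A / (A + B)) / Rpow A p * Rpow x p
  + Rpow (A + B) p * (B / (A + B)) / Rpow B p * Rpow y p.
Proof.
intros Hp Hx Hy HA HB.
pose proof (Rpow_gt0 A p HA); pose proof (Rpow_gt0 B p HB).
assert (Hs : 0 <= x / A) by (apply Rdiv_le_0_compat; easy).
assert (Ht : 0 <= y / B) by (apply Rdiv_le_0_compat; easy).
assert (Hl : 0 <= A / (A + B) <= 1).
{ split; [apply Rdiv_le_0_compat; lra |].
  apply Rmult_le_reg_r with (A + B); [lra |].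
  unfold Rdiv; rewrite Rmult_assoc, Rinv_l; lra. }
pose proof (Rpow_convex _ _ _ _ Hp Hs Ht Hl) as K.
replace (x + y) with
  ((A + B) * (A / (A + B) * (x / A) + (1 - A / (A + B)) * (y / B)))
  by (field; lra).
rewrite Rpow_mult; [| lra |].
2:{ apply Rplus_le_le_0_compat; apply Rmult_le_pos; lra. }
apply Rle_trans with (1 := Rmult_le_compat_l _ _ _ (Rpow_ge0 (A + B) p) K).
right.
replace (Rpow x p) with (Rpow A p * Rpow (x / A) p)
  by (rewrite <- Rpow_mult by lra; f_equal; field; lra).
replace (Rpow y p) with (Rpow B p * Rpow (y / B) p)
  by (rewrite <- Rpow_mult by lra; f_equal; field; lra).
field; lra.
Qed.

Lemma is_lim_seq_Rpow (u : nat -> R) (l p : R) : 0 < p ->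
  (forall n, 0 <= u n) -> is_lim_seq u l ->
  is_lim_seq (fun n => Rpow (u n) p) (Rpow l p).
Proof.
intros Hp Hu Hl.
assert (H0 : Rbar_le 0 l) by
  (apply (is_lim_seq_le (fun _ => 0) u); auto using is_lim_seq_const).
simpl in H0; destruct H0 as [H0 | <-].
- apply (is_lim_seq_continuous (fun x => Rpow x p)); [| easy].
  apply continuity_pt_ext_loc with (fun x => Rpower x p).
  + exists (mkposreal l H0); intros y Hy.
    assert (Rabs (y - l) < l) by apply Hy.
    rewrite Rpow_pos; [easy |]; revert H; unfold Rabs; destruct Rcase_abs; lra.
  + apply derivable_continuous_pt.
    exists (p * Rpower l (p - 1)); apply derivable_pt_lim_power; easy.
- rewrite Rpow_0; apply is_lim_seq_spec; intros eps.
  apply is_lim_seq_spec in Hl.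
  assert (Hd : 0 < Rpow (eps / 2) (/ p)) by
    (apply Rpow_gt0; destruct eps as [eps He]; simpl; lra).
  destruct (Hl (mkposreal _ Hd)) as [N HN]; exists N; intros n Hn.
  specialize (HN n Hn); simpl in HN.
  rewrite Rminus_0_r in *; rewrite Rabs_pos_eq in * by auto using Rpow_ge0.
  apply Rle_lt_trans with (Rpow (Rpow (eps / 2) (/ p)) p).
  + apply Rpow_le; [lra | split; [auto | lra]].
  + destruct eps as [eps He]; simpl; rewrite Rpow_inv_Rpow; lra.
Qed.

Section BanachOfNorm.

Context {K : AbsRing} (M : ModuleSpace K) (N : M -> R).
Hypothesis N_plus : forall x y, N (plus x y) <= N x + N y.
Hypothesis N_scal : forall (l : K) x, N (scal l x) <= abs l * N x.
Hypothesis N_eq0 : forall x, N x = 0 -> x = zero.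
Hypothesis N_complete : forall u : nat -> M,
  (forall eps : posreal, exists n0, forall m n,
     (n0 <= m)%nat -> (n0 <= n)%nat -> N (minus (u m) (u n)) < eps) ->
  exists l, forall eps : posreal, exists n0, forall n,
     (n0 <= n)%nat -> N (minus (u n) l) < eps.

Lemma N_zero : N zero = 0.
Proof.
assert (Hle : N zero <= 0).
{ rewrite <- (scal_zero_l (zero : M)) at 1.
  eapply Rle_trans; [apply N_scal |].
  replace (abs _) with 0 by (symmetry; apply (abs_zero (K := K))); lra. }
pose proof (N_plus zero zero) as H; rewrite plus_zero_l in H; lra.
Qed.

Lemma N_opp x : N (opp x) = N x.
Proof.
assert (H : forall y, N (opp y) <= N y).
{ intros y; rewrite <- scal_opp_one.
  eapply Rle_trans; [apply N_scal |].
  replace (abs _) with 1 by (symmetry; apply (abs_opp_one (K := K))); lra. }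
apply Rle_antisym; [apply H |].
rewrite <- (opp_opp x) at 1; apply H.
Qed.

Lemma N_minus_sym x y : N (minus x y) = N (minus y x).
Proof. rewrite <- N_opp, opp_minus; easy. Qed.

Lemma N_minus_trans x y z : N (minus x z) <= N (minus x y) + N (minus y z).
Proof. rewrite (minus_trans y); apply N_plus. Qed.

Definition banach_ball (x : M) (e : R) (y : M) : Prop := N (minus y x) < e.

Lemma banach_ball_center x (e : posreal) : banach_ball x e x.
Proof.
unfold banach_ball; rewrite minus_eq_zero.
apply (Rle_lt_trans _ 0 _ (Req_le _ _ N_zero)), cond_pos.
Qed.

Lemma banach_ball_sym x y e : banach_ball x e y -> banach_ball y e x.
Proof. unfold banach_ball; rewrite N_minus_sym; easy. Qed.

Lemma banach_ball_triangle x y z e1 e2 :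
  banach_ball x e1 y -> banach_ball y e2 z -> banach_ball x (e1 + e2) z.
Proof. unfold banach_ball; intros; pose proof (N_minus_trans z y x); lra. Qed.

Definition banach_UniformSpace_mixin : UniformSpace.mixin_of M :=
  UniformSpace.Mixin M zero banach_ball
    banach_ball_center banach_ball_sym banach_ball_triangle.

Definition banach_NormedModuleAux : NormedModuleAux K :=
  NormedModuleAux.Pack K M
    (NormedModuleAux.Class K M (ModuleSpace.class K M)
      banach_UniformSpace_mixin) M.

Definition banach_UniformSpace : UniformSpace :=
  UniformSpace.Pack M banach_UniformSpace_mixin M.

Lemma banach_norm_compat2 (x y : M) (eps : posreal) :
  banach_ball x eps y -> N (minus y x) < 1 * eps.
Proof. rewrite Rmult_1_l; easy. Qed.

Definition banach_NormedModule_mixin :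
  NormedModule.mixin_of K banach_NormedModuleAux :=
  NormedModule.Mixin K banach_NormedModuleAux N 1
    N_plus N_scal (fun _ _ _ h => h) banach_norm_compat2 N_eq0.

Lemma banach_filter_lim (F : (M -> Prop) -> Prop) :
  exists l : M, ProperFilter F -> @cauchy banach_UniformSpace F ->
    forall eps : posreal, F (banach_ball l eps).
Proof.
destruct (classic (ProperFilter F /\ @cauchy banach_UniformSpace F))
  as [[HF HC] | Hn]; [| exists zero; tauto].
assert (HC' : forall n : nat, exists x, F (banach_ball x (/ (INR n + 1)))).
{ intros n; assert (H : 0 < / (INR n + 1)) by apply RinvN_pos.
  exact (HC (mkposreal _ H)). }
pose (u := fun n => proj1_sig (constructive_indefinite_description _ (HC' n))).
assert (Hu : forall n, F (banach_ball (u n) (/ (INR n + 1)))) by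
  (intros n; apply (proj2_sig (constructive_indefinite_description _ (HC' n)))).
assert (Hinv : forall eps : posreal, exists n0, forall n, (n0 <= n)%nat ->
   / (INR n + 1) < eps / 2).
{ intros eps.
  assert (He : 0 < eps / 2) by (destruct eps; simpl; lra).
  destruct (archimed_cor1 _ He) as [n0 [H1 H2]]; exists n0; intros n Hn.
  apply le_INR in Hn; apply lt_0_INR in H2.
  apply Rle_lt_trans with (2 := H1), Rinv_le_contravar; lra. }
destruct (N_complete u) as [l Hl].
- intros eps; destruct (Hinv eps) as [n0 Hn0]; exists n0; intros m n Hm Hn.
  destruct (filter_ex _ (filter_and _ _ (Hu m) (Hu n))) as [z [Hz1 Hz2]].
  unfold banach_ball in Hz1, Hz2; rewrite N_minus_sym in Hz1.
  pose proof (N_minus_trans (u m) z (u n)).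
  pose proof (Hn0 m Hm); pose proof (Hn0 n Hn); lra.
- exists l; intros _ _ eps.
  destruct (Hinv eps) as [n0 Hn0].
  assert (He : 0 < eps / 2) by (destruct eps; simpl; lra).
  destruct (Hl (mkposreal _ He)) as [n1 Hn1]; simpl in Hn1.
  pose (n := max n0 n1).
  apply filter_imp with (2 := Hu n); intros y Hy.
  unfold banach_ball in *.
  pose proof (N_minus_trans y (u n) l).
  pose proof (Hn0 n (Nat.le_max_l _ _)).
  pose proof (Hn1 n (Nat.le_max_r _ _)); lra.
Qed.

Definition banach_lim (F : (M -> Prop) -> Prop) : M :=
  proj1_sig (constructive_indefinite_description _ (banach_filter_lim F)).

Lemma banach_lim_cauchy (F : (M -> Prop) -> Prop) :
  ProperFilter F -> @cauchy banach_UniformSpace F ->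
  forall eps : posreal, F (banach_ball (banach_lim F) eps).
Proof.
exact (proj2_sig (constructive_indefinite_description _ (banach_filter_lim F))).
Qed.

Lemma banach_close_lim (F1 F2 : (M -> Prop) -> Prop) :
  filter_le F1 F2 -> filter_le F2 F1 ->
  @close banach_UniformSpace (banach_lim F1) (banach_lim F2).
Proof.
intros H12 H21.
replace F2 with F1; [intros eps; apply banach_ball_center |].
apply functional_extensionality; intros P.
apply propositional_extensionality; split; [apply H21 | apply H12].
Qed.

Definition banach_CompleteSpace_mixin :
  CompleteSpace.mixin_of banach_UniformSpace :=
  CompleteSpace.Mixin banach_UniformSpace banach_lim
    banach_lim_cauchy banach_close_lim.

Definition banach_of_norm : CompleteNormedModule K :=
  CompleteNormedModule.Pack K M
    (CompleteNormedModule.Class K M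
      (NormedModule.Class K M
        (NormedModuleAux.Class K M (ModuleSpace.class K M)
          banach_UniformSpace_mixin)
        banach_NormedModule_mixin)
      banach_CompleteSpace_mixin) M.

End BanachOfNorm.

Lemma cauchy_seq_lim {K : AbsRing} {V : CompleteNormedModule K} (u : nat -> V) :
  (forall eps : posreal, exists n0, forall m n,
     (n0 <= m)%nat -> (n0 <= n)%nat -> norm (minus (u m) (u n)) < eps) ->
  exists l, forall eps : posreal, exists n0, forall n,
     (n0 <= n)%nat -> norm (minus (u n) l) < eps.
Proof.
intros HC.
destruct (proj1 (filterlim_locally_cauchy (F := eventually) u)) as [l Hl].
- intros eps; destruct (HC eps) as [n0 Hn0].
  exists (fun n => (n0 <= n)%nat); split; [exists n0; easy |].
  intros m n Hm Hn; apply (norm_compat1 (V := V)); auto.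
- exists l; intros eps.
  apply (Hl (fun y => norm (minus y l) < eps)).
  apply (locally_le_locally_norm (V := V) l).
  exists eps; easy.
Qed.

(* [m_infty] is a junk case: every use is guarded by [Rbar_le 1 p]. *)
Definition pair_norm (p : Rbar) (x y : R) : R :=
  match p with
  | Finite q => Rpow (Rpow x q + Rpow y q) (/ q)
  | _ => Rmax x y
  end.

Lemma pair_norm_le p x y A : Rbar_le 1 p -> 0 <= x -> 0 <= y -> 0 <= A ->
  (pair_norm p x y <= A <->
   match p with Finite q => Rpow x q + Rpow y q <= Rpow A q
              | _ => x <= A /\ y <= A end).
Proof.
intros Hp Hx Hy HA; destruct p as [q | |]; simpl in *; try easy.
- apply Rpow_inv_le; try lra.
  pose proof (Rpow_ge0 x q); pose proof (Rpow_ge0 y q); lra.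
- unfold Rmax; destruct Rle_dec; lra.
Qed.

Lemma pair_norm_ge p x y : Rbar_le 1 p -> 0 <= x -> 0 <= y ->
  0 <= pair_norm p x y /\ x <= pair_norm p x y /\ y <= pair_norm p x y.
Proof.
intros Hp Hx Hy; destruct p as [q | |]; simpl in *; try easy.
- pose proof (Rpow_ge0 x q); pose proof (Rpow_ge0 y q).
  assert (0 < / q) by (apply Rinv_0_lt_compat; lra).
  repeat split; [apply Rpow_ge0 | |].
  + rewrite <- (Rpow_Rpow_inv x q) at 1 by lra; apply Rpow_le; lra.
  + rewrite <- (Rpow_Rpow_inv y q) at 1 by lra; apply Rpow_le; lra.
- unfold Rmax; destruct Rle_dec; lra.
Qed.

Lemma pair_norm_mono p x y x' y' : Rbar_le 1 p -> 0 <= x <= x' -> 0 <= y <= y' ->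
  pair_norm p x y <= pair_norm p x' y'.
Proof.
intros Hp Hx Hy; destruct p as [q | |]; simpl in *; try easy.
- assert (0 < / q) by (apply Rinv_0_lt_compat; lra).
  pose proof (Rpow_ge0 x q); pose proof (Rpow_ge0 y q).
  apply Rpow_le; [lra | split; [lra |]].
  apply Rplus_le_compat; apply Rpow_le; lra.
- unfold Rmax; repeat destruct Rle_dec; lra.
Qed.

Lemma pair_norm_minkowski p x y x' y' : Rbar_le 1 p ->
  0 <= x -> 0 <= y -> 0 <= x' -> 0 <= y' ->
  pair_norm p (x + x') (y + y') <= pair_norm p x y + pair_norm p x' y'.
Proof.
intros Hp Hx Hy Hx' Hy'.
destruct (pair_norm_ge p x y Hp Hx Hy) as [H0 _].
destruct (pair_norm_ge p x' y' Hp Hx' Hy') as [H0' _].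
apply le_epsilon; intros eps He.
set (A := pair_norm p x y + eps / 2); set (B := pair_norm p x' y' + eps / 2).
replace (pair_norm p x y + pair_norm p x' y' + eps) with (A + B)
  by (unfold A, B; lra).
assert (HA : 0 < A) by (unfold A; lra); assert (HB : 0 < B) by (unfold B; lra).
assert (KA : pair_norm p x y <= A) by (unfold A; lra).
assert (KB : pair_norm p x' y' <= B) by (unfold B; lra).
apply pair_norm_le; try lra; try easy.
apply pair_norm_le in KA; try lra; try easy.
apply pair_norm_le in KB; try lra; try easy.
destruct p as [q | |]; simpl in *; try easy; [| lra].
pose proof (Rpow_plus_le x x' A B q Hp Hx Hx' HA HB) as K1.
pose proof (Rpow_plus_le y y' A B q Hp Hy Hy' HA HB) as K2.
set (c := Rpow (A + B) q * (A / (A + B)) / Rpow A q) in *.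
set (d := Rpow (A + B) q * (B / (A + B)) / Rpow B q) in *.
pose proof (Rpow_gt0 A q HA); pose proof (Rpow_gt0 B q HB).
assert (Hab : 0 < A + B) by lra.
pose proof (Rpow_gt0 (A + B) q Hab).
assert (Hc : 0 < c).
{ unfold c; repeat (apply Rdiv_lt_0_compat || apply Rmult_lt_0_compat); easy. }
assert (Hd : 0 < d).
{ unfold d; repeat (apply Rdiv_lt_0_compat || apply Rmult_lt_0_compat); easy. }
apply Rle_trans with (c * Rpow A q + d * Rpow B q).
- apply Rle_trans with
    (c * (Rpow x q + Rpow y q) + d * (Rpow x' q + Rpow y' q)); [lra |].
  apply Rplus_le_compat; apply Rmult_le_compat_l; lra.
- right; unfold c, d; field; lra.
Qed.

Lemma pair_norm_scal p c x y : Rbar_le 1 p -> 0 <= c -> 0 <= x -> 0 <= y ->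
  pair_norm p (c * x) (c * y) <= c * pair_norm p x y.
Proof.
intros Hp Hc Hx Hy.
destruct (pair_norm_ge p x y Hp Hx Hy) as [H0 _].
apply pair_norm_le; try apply Rmult_le_pos; try easy.
pose proof (Rle_refl (pair_norm p x y)) as K.
apply pair_norm_le in K; try easy.
destruct p as [q | |]; try easy.
- rewrite !Rpow_mult by easy; rewrite <- Rmult_plus_distr_l.
  apply Rmult_le_compat_l; [apply Rpow_ge0 | easy].
- split; apply Rmult_le_compat_l; easy.
Qed.

Section Boxplus.

Context {K : AbsRing} (p : Rbar) (hp : Rbar_le 1 p) (V W : CompleteNormedModule K).

Definition boxplus_norm (x : prod_ModuleSpace K V W) : R :=
  pair_norm p (norm (fst x)) (norm (snd x)).

Lemma boxplus_norm_plus x y :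
  boxplus_norm (plus x y) <= boxplus_norm x + boxplus_norm y.
Proof.
unfold boxplus_norm; eapply Rle_trans;
  [| apply pair_norm_minkowski; auto using norm_ge_0].
apply pair_norm_mono; auto; split; try apply norm_ge_0; simpl.
- apply (norm_triangle (V := V)).
- apply (norm_triangle (V := W)).
Qed.

Lemma boxplus_norm_scal (l : K) x :
  boxplus_norm (scal l x) <= abs l * boxplus_norm x.
Proof.
unfold boxplus_norm; eapply Rle_trans;
  [| apply pair_norm_scal; auto using norm_ge_0, abs_ge_0].
apply pair_norm_mono; auto; split; try apply norm_ge_0; simpl.
- apply (norm_scal (V := V)).
- apply (norm_scal (V := W)).
Qed.

Lemma boxplus_norm_ge x :
  norm (fst x) <= boxplus_norm x /\ norm (snd x) <= boxplus_norm x.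
Proof.
destruct (pair_norm_ge p (norm (fst x)) (norm (snd x)) hp) as [_ H];
  auto using norm_ge_0.
Qed.

Lemma boxplus_norm_eq0 x : boxplus_norm x = 0 -> x = zero.
Proof.
intros H; destruct (boxplus_norm_ge x) as [H1 H2]; rewrite H in H1, H2.
destruct x as [v w]; simpl in *.
pose proof (norm_ge_0 v); pose proof (norm_ge_0 w).
apply injective_projections; simpl.
- apply (norm_eq_zero (V := V)); lra.
- apply (norm_eq_zero (V := W)); lra.
Qed.

Lemma boxplus_norm_le_sum x :
  boxplus_norm x <= norm (fst x) + norm (snd x).
Proof.
destruct x as [v w]; unfold boxplus_norm; simpl.
pose proof (norm_ge_0 v); pose proof (norm_ge_0 w).
rewrite <- (Rplus_0_r (norm v)) at 1; rewrite <- (Rplus_0_l (norm w)) at 1.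
eapply Rle_trans; [apply pair_norm_minkowski; try lra; easy |].
destruct p as [q | |]; simpl in *; try easy.
- rewrite !Rpow_0, Rplus_0_l, Rplus_0_r, !Rpow_Rpow_inv; lra.
- unfold Rmax; repeat destruct Rle_dec; lra.
Qed.

Lemma boxplus_complete (u : nat -> prod_ModuleSpace K V W) :
  (forall eps : posreal, exists n0, forall m n,
     (n0 <= m)%nat -> (n0 <= n)%nat -> boxplus_norm (minus (u m) (u n)) < eps) ->
  exists l, forall eps : posreal, exists n0, forall n,
     (n0 <= n)%nat -> boxplus_norm (minus (u n) l) < eps.
Proof.
intros HC.
destruct (cauchy_seq_lim (fun n => fst (u n))) as [v Hv].
{ intros eps; destruct (HC eps) as [n0 Hn0]; exists n0; intros m n Hm Hn.
  eapply Rle_lt_trans; [| apply (Hn0 m n Hm Hn)].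
  apply (boxplus_norm_ge (minus (u m) (u n))). }
destruct (cauchy_seq_lim (fun n => snd (u n))) as [w Hw].
{ intros eps; destruct (HC eps) as [n0 Hn0]; exists n0; intros m n Hm Hn.
  eapply Rle_lt_trans; [| apply (Hn0 m n Hm Hn)].
  apply (boxplus_norm_ge (minus (u m) (u n))). }
exists (v, w); intros eps.
assert (He : 0 < eps / 2) by (destruct eps; simpl; lra).
destruct (Hv (mkposreal _ He)) as [n1 H1]; destruct (Hw (mkposreal _ He)) as [n2 H2].
simpl in H1, H2.
exists (max n1 n2); intros n Hn.
eapply Rle_lt_trans; [apply boxplus_norm_le_sum |].
specialize (H1 n ltac:(lia)); specialize (H2 n ltac:(lia)).
apply Rlt_le_trans with (eps / 2 + eps / 2); [| lra].
apply Rplus_lt_compat; [exact H1 | exact H2].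
Qed.

Definition boxplus : CompleteNormedModule K :=
  banach_of_norm (prod_ModuleSpace K V W) boxplus_norm
    boxplus_norm_plus boxplus_norm_scal boxplus_norm_eq0 boxplus_complete.

End Boxplus.

Section SequenceModule.

Context {K : AbsRing} {V : CompleteNormedModule K} (P : (nat -> V) -> Prop).
Hypothesis P_zero : P (fun _ => zero).
Hypothesis P_plus : forall a b, P a -> P b -> P (fun n => plus (a n) (b n)).
Hypothesis P_scal : forall (k : K) a, P a -> P (fun n => scal k (a n)).

Definition seq_sub : Type := {a : nat -> V | P a}.

Lemma seq_sub_eq (a b : seq_sub) :
  (forall n, proj1_sig a n = proj1_sig b n) -> a = b.
Proof.
destruct a as [a Ha], b as [b Hb]; simpl; intros H.
assert (a = b) by (apply functional_extensionality; easy).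
subst b; f_equal; apply proof_irrelevance.
Qed.

Lemma P_opp a : P a -> P (fun n => opp (a n)).
Proof.
intros Ha; replace (fun n => opp (a n)) with (fun n => scal (opp one) (a n)).
- apply P_scal; easy.
- apply functional_extensionality; intros n; apply (scal_opp_one (V := V)).
Qed.

Definition seq_zero : seq_sub := exist P _ P_zero.
Definition seq_plus (a b : seq_sub) : seq_sub :=
  exist P _ (P_plus _ _ (proj2_sig a) (proj2_sig b)).
Definition seq_opp (a : seq_sub) : seq_sub := exist P _ (P_opp _ (proj2_sig a)).
Definition seq_scal (k : K) (a : seq_sub) : seq_sub :=
  exist P _ (P_scal k _ (proj2_sig a)).

Lemma seq_plus_comm a b : seq_plus a b = seq_plus b a.
Proof. apply seq_sub_eq; intros n; apply (plus_comm (G := V)). Qed.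

Lemma seq_plus_assoc a b c : seq_plus a (seq_plus b c) = seq_plus (seq_plus a b) c.
Proof. apply seq_sub_eq; intros n; apply (plus_assoc (G := V)). Qed.

Lemma seq_plus_zero_r a : seq_plus a seq_zero = a.
Proof. apply seq_sub_eq; intros n; apply (plus_zero_r (G := V)). Qed.

Lemma seq_plus_opp_r a : seq_plus a (seq_opp a) = seq_zero.
Proof. apply seq_sub_eq; intros n; apply (plus_opp_r (G := V)). Qed.

Definition seq_AbelianMonoid : AbelianMonoid :=
  AbelianMonoid.Pack seq_sub
    (AbelianMonoid.Mixin seq_sub seq_plus seq_zero
      seq_plus_comm seq_plus_assoc seq_plus_zero_r) seq_sub.

Definition seq_AbelianGroup : AbelianGroup :=
  AbelianGroup.Pack seq_sub
    (AbelianGroup.Class seq_sub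
      (AbelianMonoid.class seq_AbelianMonoid)
      (AbelianGroup.Mixin seq_AbelianMonoid seq_opp seq_plus_opp_r)) seq_sub.

Lemma seq_scal_assoc (x y : K) a : seq_scal x (seq_scal y a) = seq_scal (mult x y) a.
Proof. apply seq_sub_eq; intros n; apply (scal_assoc (V := V)). Qed.

Lemma seq_scal_one a : seq_scal one a = a.
Proof. apply seq_sub_eq; intros n; apply (scal_one (V := V)). Qed.

Lemma seq_scal_distr_l (x : K) a b :
  seq_scal x (seq_plus a b) = seq_plus (seq_scal x a) (seq_scal x b).
Proof. apply seq_sub_eq; intros n; apply (scal_distr_l (V := V)). Qed.

Lemma seq_scal_distr_r (x y : K) a :
  seq_scal (plus x y) a = seq_plus (seq_scal x a) (seq_scal y a).
Proof. apply seq_sub_eq; intros n; apply (scal_distr_r (V := V)). Qed.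

Definition seq_ModuleSpace : ModuleSpace K :=
  ModuleSpace.Pack K seq_sub
    (ModuleSpace.Class K seq_sub (AbelianGroup.class seq_AbelianGroup)
      (ModuleSpace.Mixin K seq_AbelianGroup seq_scal
        seq_scal_assoc seq_scal_one seq_scal_distr_l seq_scal_distr_r)) seq_sub.

End SequenceModule.

Definition p_summable {K : AbsRing} {V : NormedModule K} (p : R) (a : nat -> V) : Prop :=
  ex_series (fun n => Rpow (norm (a n)) p).

Definition lp_norm {K : AbsRing} {V : NormedModule K} (p : R) (a : nat -> V) : R :=
  Rpow (Series (fun n => Rpow (norm (a n)) p)) (/ p).

Section LpBound.

Context {K : AbsRing} {V : CompleteNormedModule K} (p : R) (hp : 1 <= p).

Definition lp_bound (a : nat -> V) (A : R) : Prop :=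
  forall n, sum_n (fun k => Rpow (norm (a k)) p) n <= Rpow A p.

Lemma lp_sum_incr (a : nat -> V) n :
  sum_n (fun k => Rpow (norm (a k)) p) n <= sum_n (fun k => Rpow (norm (a k)) p) (S n).
Proof.
rewrite sum_Sn; unfold plus; simpl.
pose proof (Rpow_ge0 (norm (a (S n))) p); lra.
Qed.

Lemma lp_bound_summable a A : lp_bound a A -> p_summable p a.
Proof.
intros H; apply ex_finite_lim_seq_incr with (M := Rpow A p) in H;
  [| apply lp_sum_incr].
destruct H as [l Hl]; exists l; exact Hl.
Qed.

Lemma lp_series_ge0 (a : nat -> V) : p_summable p a ->
  0 <= Series (fun n => Rpow (norm (a n)) p).
Proof.
intros Hs; apply Series_correct in Hs.
pose proof (is_lim_seq_incr_compare _ _ Hs (lp_sum_incr a) 0%nat) as H.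
rewrite sum_O in H; apply Rle_trans with (2 := H), Rpow_ge0.
Qed.

Lemma lp_bound_norm a A : 0 <= A -> lp_bound a A -> lp_norm p a <= A.
Proof.
intros HA H; pose proof (lp_bound_summable a A H) as Hs.
apply Rpow_inv_le; try lra.
- apply lp_series_ge0; easy.
- apply Series_correct in Hs.
  apply (is_lim_seq_le _ (fun _ => Rpow A p)
    (Series (fun n => Rpow (norm (a n)) p)) (Rpow A p) H Hs).
  apply is_lim_seq_const.
Qed.

Lemma lp_norm_ge0 (a : nat -> V) : 0 <= lp_norm p a.
Proof. apply Rpow_ge0. Qed.

Lemma lp_norm_bound a A : p_summable p a -> lp_norm p a <= A -> lp_bound a A.
Proof.
intros Hs HA; pose proof (lp_norm_ge0 a).
pose proof (lp_series_ge0 a Hs) as H0.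
apply Rpow_inv_le in HA; try lra.
intros n; apply Rle_trans with (2 := HA).
apply Series_correct in Hs.
apply (is_lim_seq_incr_compare _ _ Hs (lp_sum_incr a)).
Qed.

Lemma lp_bound_plus a b A B : 0 < A -> 0 < B -> lp_bound a A -> lp_bound b B ->
  lp_bound (fun n => plus (a n) (b n)) (A + B).
Proof.
intros HA HB Ha Hb n.
pose proof (Rpow_gt0 A p HA); pose proof (Rpow_gt0 B p HB).
assert (Hab : 0 < A + B) by lra.
pose proof (Rpow_gt0 (A + B) p Hab).
set (c := Rpow (A + B) p * (A / (A + B)) / Rpow A p).
set (d := Rpow (A + B) p * (B / (A + B)) / Rpow B p).
assert (Hc : 0 < c).
{ unfold c; repeat (apply Rdiv_lt_0_compat || apply Rmult_lt_0_compat); easy. }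
assert (Hd : 0 < d).
{ unfold d; repeat (apply Rdiv_lt_0_compat || apply Rmult_lt_0_compat); easy. }
apply Rle_trans with
  (sum_n (fun k => plus (scal c (Rpow (norm (a k)) p)) (scal d (Rpow (norm (b k)) p))) n).
- apply sum_n_m_le; intros k.
  eapply Rle_trans.
  + apply Rpow_le; [lra | split; [apply norm_ge_0 | apply (norm_triangle (V := V))]].
  + apply Rpow_plus_le; auto using norm_ge_0.
- rewrite sum_n_plus, !sum_n_scal_l; unfold plus, scal; simpl; unfold mult; simpl.
  apply Rle_trans with (c * Rpow A p + d * Rpow B p).
  + apply Rplus_le_compat; apply Rmult_le_compat_l; auto; lra.
  + right; unfold c, d; field; lra.
Qed.

Lemma lp_bound_scal (k : K) a A : 0 <= A -> lp_bound a A ->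
  lp_bound (fun n => scal k (a n)) (abs k * A).
Proof.
intros HA Ha n.
rewrite Rpow_mult by auto using abs_ge_0.
eapply Rle_trans; [| apply Rmult_le_compat_l; [apply Rpow_ge0 | apply (Ha n)]].
apply Rle_trans with (sum_n (fun j => Rpow (abs k) p * Rpow (norm (a j)) p) n);
  [| right; apply (sum_n_mult_l (K := R_Ring))].
apply sum_n_m_le; intros j.
rewrite <- Rpow_mult by auto using abs_ge_0, norm_ge_0.
apply Rpow_le; [lra | split; [apply norm_ge_0 | apply (norm_scal (V := V))]].
Qed.

Lemma lp_bound_term a A n : 0 <= A -> lp_bound a A -> norm (a n) <= A.
Proof.
intros HA Ha.
rewrite <- (Rpow_Rpow_inv (norm (a n)) p) by (try lra; apply norm_ge_0).
apply Rpow_inv_le; try lra; [apply Rpow_ge0 |].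
apply Rle_trans with (2 := Ha n).
destruct n as [| n]; [rewrite sum_O; lra |].
rewrite sum_Sn; unfold plus; simpl.
enough (0 <= sum_n (fun k => Rpow (norm (a k)) p) n) by lra.
clear; induction n as [| n IH]; [rewrite sum_O; apply Rpow_ge0 |].
apply Rle_trans with (1 := IH), lp_sum_incr.
Qed.

Lemma lp_bound_lim (u : nat -> nat -> V) a A :
  (forall k, lp_bound (u k) A) ->
  (forall n, is_lim_seq (fun k => norm (u k n)) (norm (a n))) ->
  lp_bound a A.
Proof.
intros Hu Ha n.
apply (is_lim_seq_le
  (fun k => sum_n (fun j => Rpow (norm (u k j)) p) n) (fun _ => Rpow A p)
  (sum_n (fun j => Rpow (norm (a j)) p) n) (Rpow A p)).
- intros k; apply Hu.
- assert (Hj : forall j, is_lim_seq (fun k => Rpow (norm (u k j)) p)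
                           (Rpow (norm (a j)) p)).
  { intros j; apply is_lim_seq_Rpow; [lra | intros k; apply norm_ge_0 | apply Ha]. }
  induction n as [| n IH].
  + rewrite sum_O; apply is_lim_seq_ext with (2 := Hj 0%nat).
    intros k; rewrite sum_O; easy.
  + rewrite sum_Sn.
    apply is_lim_seq_ext with
      (fun k => sum_n (fun j => Rpow (norm (u k j)) p) n + Rpow (norm (u k (S n))) p).
    * intros k; rewrite sum_Sn; easy.
    * apply is_lim_seq_plus'; [apply IH | apply Hj].
- apply is_lim_seq_const.
Qed.

Lemma p_summable_zero : p_summable p (fun _ => zero : V).
Proof.
apply (lp_bound_summable _ 0); intros n.
rewrite Rpow_0; right.
rewrite (sum_n_ext _ (fun _ => 0)); [rewrite sum_n_const; ring |].
intros k; transitivity (Rpow 0 p); [| apply Rpow_0].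
f_equal; apply (norm_zero (V := V)).
Qed.

Lemma p_summable_bound a eps : 0 < eps -> p_summable p a ->
  lp_bound a (lp_norm p a + eps) /\ 0 < lp_norm p a + eps.
Proof.
intros He Ha; pose proof (lp_norm_ge0 a).
split; [apply lp_norm_bound; [easy |] |]; lra.
Qed.

Lemma p_summable_plus (a b : nat -> V) : p_summable p a -> p_summable p b ->
  p_summable p (fun n => plus (a n) (b n)).
Proof.
intros Ha Hb.
destruct (p_summable_bound a 1 Rlt_0_1 Ha) as [Ka La].
destruct (p_summable_bound b 1 Rlt_0_1 Hb) as [Kb Lb].
eapply lp_bound_summable, lp_bound_plus; [exact La | exact Lb | |]; easy.
Qed.

Lemma p_summable_scal (k : K) (a : nat -> V) : p_summable p a ->
  p_summable p (fun n => scal k (a n)).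
Proof.
intros Ha.
destruct (p_summable_bound a 1 Rlt_0_1 Ha) as [Ka La].
eapply lp_bound_summable, lp_bound_scal; [| exact Ka]; lra.
Qed.

End LpBound.

Lemma minus_minus_cancel {G : AbelianGroup} (b u l : G) :
  minus (minus b u) (minus b l) = minus l u.
Proof.
rewrite (minus_trans b l u), <- (opp_minus b l).
apply (plus_comm (G := G)).
Qed.

Lemma plus_opp_minus {G : AbelianGroup} (x l : G) : plus x (opp (minus x l)) = l.
Proof.
rewrite opp_minus; etransitivity; [apply (plus_comm (G := G)) |].
rewrite <- (minus_zero_r x) at 2; rewrite <- (minus_trans x).
apply minus_zero_r.
Qed.

Lemma is_lim_seq_norm_minus {K : AbsRing} {V : NormedModule K}
  (u : nat -> V) (l b : V) :
  (forall eps : posreal, exists n0, forall n,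
     (n0 <= n)%nat -> norm (minus (u n) l) < eps) ->
  is_lim_seq (fun n => norm (minus b (u n))) (norm (minus b l)).
Proof.
intros H; apply is_lim_seq_spec; intros eps.
destruct (H eps) as [n0 Hn0]; exists n0; intros n Hn.
apply Rle_lt_trans with (2 := Hn0 n Hn).
eapply Rle_trans; [apply (norm_triangle_inv (minus b (u n)) (minus b l)) |].
right; rewrite <- (norm_opp (minus (u n) l)); f_equal.
etransitivity; [apply (minus_minus_cancel (G := V)) |].
symmetry; apply (opp_minus (G := V)).
Qed.

Section Lp.

Context {K : AbsRing} (V : CompleteNormedModule K) (p : R) (hp : 1 <= p).

Definition lp_ModuleSpace : ModuleSpace K :=
  seq_ModuleSpace (V := V) (p_summable p)
    (p_summable_zero p) (p_summable_plus p hp) (p_summable_scal p hp).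

Definition lp_space_norm (a : lp_ModuleSpace) : R := lp_norm p (proj1_sig a).

Lemma lp_space_norm_plus a b :
  lp_space_norm (plus a b) <= lp_space_norm a + lp_space_norm b.
Proof.
apply le_epsilon; intros eps He.
assert (He2 : 0 < eps / 2) by lra.
destruct (p_summable_bound p hp _ _ He2 (proj2_sig a)) as [Ka La].
destruct (p_summable_bound p hp _ _ He2 (proj2_sig b)) as [Kb Lb].
fold (lp_space_norm a) in *; fold (lp_space_norm b) in *.
replace (lp_space_norm a + lp_space_norm b + eps) with
  ((lp_space_norm a + eps / 2) + (lp_space_norm b + eps / 2)) by lra.
apply lp_bound_norm; [easy | lra | apply lp_bound_plus; easy].
Qed.

Lemma lp_space_norm_scal (k : K) a :
  lp_space_norm (scal k a) <= abs k * lp_space_norm a.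
Proof.
pose proof (lp_norm_ge0 p (proj1_sig a)).
apply lp_bound_norm; [easy | |].
- apply Rmult_le_pos; [apply abs_ge_0 | easy].
- apply lp_bound_scal; [easy | easy |].
  apply lp_norm_bound; [easy | apply (proj2_sig a) | apply Rle_refl].
Qed.

Lemma lp_space_norm_term (a : lp_ModuleSpace) n :
  norm (proj1_sig a n) <= lp_space_norm a.
Proof.
apply (lp_bound_term p hp); [apply lp_norm_ge0 |].
apply lp_norm_bound; [easy | apply (proj2_sig a) | apply Rle_refl].
Qed.

Lemma lp_space_norm_eq0 a : lp_space_norm a = 0 -> a = zero.
Proof.
intros H; apply seq_sub_eq; intros n; apply (norm_eq_zero (V := V)).
pose proof (lp_space_norm_term a n); pose proof (norm_ge_0 (proj1_sig a n)); lra.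
Qed.

Lemma lp_space_complete (u : nat -> lp_ModuleSpace) :
  (forall eps : posreal, exists n0, forall m n,
     (n0 <= m)%nat -> (n0 <= n)%nat -> lp_space_norm (minus (u m) (u n)) < eps) ->
  exists l, forall eps : posreal, exists n0, forall n,
     (n0 <= n)%nat -> lp_space_norm (minus (u n) l) < eps.
Proof.
intros HC.
assert (HL : forall j, exists l, forall eps : posreal, exists n0, forall n,
  (n0 <= n)%nat -> norm (minus (proj1_sig (u n) j) l) < eps).
{ intros j; apply (cauchy_seq_lim (fun n => proj1_sig (u n) j)).
  intros eps; destruct (HC eps) as [n0 Hn0]; exists n0; intros m n Hm Hn.
  eapply Rle_lt_trans; [| apply (Hn0 m n Hm Hn)].
  apply (lp_space_norm_term (minus (u m) (u n)) j). }
pose (l := fun j => proj1_sig (constructive_indefinite_description _ (HL j))).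
assert (Hl : forall j, forall eps : posreal, exists n0, forall n,
  (n0 <= n)%nat -> norm (minus (proj1_sig (u n) j) (l j)) < eps) by
  (intros j; apply (proj2_sig (constructive_indefinite_description _ (HL j)))).
assert (HB : forall eps : posreal, exists n0, forall n, (n0 <= n)%nat ->
  lp_bound p (fun j => minus (proj1_sig (u n) j) (l j)) eps).
{ intros eps; destruct (HC eps) as [n0 Hn0]; exists n0; intros n Hn.
  apply (lp_bound_lim p hp)
    with (u := fun k j => minus (proj1_sig (u n) j) (proj1_sig (u (k + n0)%nat) j)).
  - intros k.
    apply (lp_norm_bound p hp _ _ (proj2_sig (minus (u n) (u (k + n0)%nat)))).
    left; apply (Hn0 n (k + n0)%nat); lia.
  - intros j.
    apply (is_lim_seq_incr_n
      (fun k => norm (minus (proj1_sig (u n) j) (proj1_sig (u k) j))) n0).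
    exact (is_lim_seq_norm_minus (V := V) (fun k => proj1_sig (u k) j) (l j)
      (proj1_sig (u n) j) (Hl j)). }
assert (HP : p_summable p l).
{ destruct (HB (mkposreal 1 Rlt_0_1)) as [n0 Hn0].
  specialize (Hn0 n0 (le_n _)); apply lp_bound_summable in Hn0.
  apply (p_summable_scal p hp (opp one)) in Hn0.
  pose proof (p_summable_plus p hp _ _ (proj2_sig (u n0)) Hn0) as Hs.
  revert Hs; apply ex_series_ext; intros j; f_equal; f_equal.
  rewrite (scal_opp_one (V := V)); apply (plus_opp_minus (G := V)). }
exists (exist _ l HP); intros eps.
assert (He : 0 < eps / 2) by (destruct eps; simpl; lra).
destruct (HB (mkposreal _ He)) as [n0 Hn0]; exists n0; intros n Hn.
apply Rle_lt_trans with (eps / 2); [| destruct eps; simpl; lra].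
apply lp_bound_norm; [easy | lra | apply (Hn0 n Hn)].
Qed.

Definition lp_space : CompleteNormedModule K :=
  banach_of_norm lp_ModuleSpace lp_space_norm
    lp_space_norm_plus lp_space_norm_scal lp_space_norm_eq0 lp_space_complete.

End Lp.

Definition null_seq {K : AbsRing} {V : NormedModule K} (a : nat -> V) : Prop :=
  filterlim a eventually (locally (zero : V)).

(* [Sup_seq] is finite here, since only bounded sequences are considered. *)
Definition sup_norm {K : AbsRing} {V : NormedModule K} (a : nat -> V) : R :=
  real (Sup_seq (fun n => Finite (norm (a n)))).

Section SupNorm.

Context {K : AbsRing} {V : CompleteNormedModule K}.

Lemma sup_norm_is_sup (a : nat -> V) A : (forall n, norm (a n) <= A) ->
  is_sup_seq (fun n => Finite (norm (a n))) (Finite (sup_norm a)).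
Proof.
intros HA; unfold sup_norm.
pose proof (Sup_seq_correct (fun n => Finite (norm (a n)))) as H.
destruct (Sup_seq (fun n => Finite (norm (a n)))) as [l | |]; simpl; [easy | |].
- exfalso; destruct (H A) as [n Hn]; simpl in Hn; specialize (HA n); lra.
- exfalso; specialize (H 0 0%nat); simpl in H.
  pose proof (norm_ge_0 (a 0%nat)); lra.
Qed.

Lemma sup_norm_term (a : nat -> V) A n : (forall n, norm (a n) <= A) ->
  norm (a n) <= sup_norm a.
Proof.
intros HA; pose proof (sup_norm_is_sup a A HA) as H.
apply le_epsilon; intros eps He.
destruct (H (mkposreal eps He)) as [H1 _]; specialize (H1 n); simpl in H1; lra.
Qed.

Lemma sup_norm_le (a : nat -> V) A : (forall n, norm (a n) <= A) -> sup_norm a <= A.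
Proof.
intros HA; pose proof (sup_norm_is_sup a A HA) as H.
apply le_epsilon; intros eps He.
destruct (H (mkposreal eps He)) as [_ [n H2]]; simpl in H2.
specialize (HA n); lra.
Qed.

Lemma null_seq_lim (a : nat -> V) : null_seq a -> is_lim_seq (fun n => norm (a n)) 0.
Proof.
intros H.
replace (Finite 0) with (Finite (norm (zero : V)))
  by (f_equal; apply (norm_zero (V := V))).
apply (filterlim_comp _ _ _ a norm _ (locally (zero : V)) _ H).
apply (filterlim_norm (V := V)).
Qed.

Lemma lim_null_seq (a : nat -> V) : is_lim_seq (fun n => norm (a n)) 0 -> null_seq a.
Proof. apply (filterlim_norm_zero (V := V)). Qed.

Lemma null_seq_zero : null_seq (fun _ => zero : V).
Proof. apply filterlim_const. Qed.

Lemma null_seq_plus (a b : nat -> V) : null_seq a -> null_seq b ->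
  null_seq (fun n => plus (a n) (b n)).
Proof.
intros Ha Hb; apply lim_null_seq.
apply is_lim_seq_le_le with (fun _ => 0) (fun n => norm (a n) + norm (b n)).
- intros n; split; [apply (norm_ge_0 (V := V)) | apply (norm_triangle (V := V))].
- apply is_lim_seq_const.
- replace 0 with (0 + 0) by ring.
  apply is_lim_seq_plus'; apply null_seq_lim; easy.
Qed.

Lemma null_seq_scal (k : K) (a : nat -> V) : null_seq a ->
  null_seq (fun n => scal k (a n)).
Proof.
intros Ha; apply lim_null_seq.
apply is_lim_seq_le_le with (fun _ => 0) (fun n => abs k * norm (a n)).
- intros n; split; [apply (norm_ge_0 (V := V)) | apply (norm_scal (V := V))].
- apply is_lim_seq_const.
- replace (Finite 0) with (Rbar_mult (abs k) 0) by (simpl; f_equal; ring).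
  apply is_lim_seq_scal_l, null_seq_lim; easy.
Qed.

Lemma null_seq_bounded (a : nat -> V) : null_seq a ->
  exists A, forall n, norm (a n) <= A.
Proof.
intros Ha; apply null_seq_lim, is_lim_seq_spec in Ha.
destruct (Ha (mkposreal 1 Rlt_0_1)) as [n0 H0]; simpl in H0.
assert (H : forall m, exists A, forall n, (n < m)%nat -> norm (a n) <= A).
{ induction m as [| m [A HA]]; [exists 0; lia |].
  exists (Rmax A (norm (a m))); intros n Hn.
  destruct (Nat.eq_dec n m) as [-> | Hne]; [apply Rmax_r |].
  apply Rle_trans with A; [apply HA; lia | apply Rmax_l]. }
destruct (H n0) as [A HA]; exists (Rmax A 1); intros n.
destruct (Nat.lt_ge_cases n n0) as [Hn | Hn].
- apply Rle_trans with A; [auto | apply Rmax_l].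
- apply Rle_trans with 1; [| apply Rmax_r].
  specialize (H0 n Hn); rewrite Rminus_0_r in H0.
  rewrite Rabs_pos_eq in H0 by apply norm_ge_0; lra.
Qed.

End SupNorm.

Section C0.

Context {K : AbsRing} (V : CompleteNormedModule K).

Definition c0_ModuleSpace : ModuleSpace K :=
  seq_ModuleSpace (V := V) null_seq null_seq_zero null_seq_plus null_seq_scal.

Definition c0_norm (a : c0_ModuleSpace) : R := sup_norm (proj1_sig a).

Lemma c0_norm_term (a : c0_ModuleSpace) n : norm (proj1_sig a n) <= c0_norm a.
Proof.
destruct (null_seq_bounded _ (proj2_sig a)) as [A HA].
apply sup_norm_term with A; easy.
Qed.

Lemma c0_norm_plus a b : c0_norm (plus a b) <= c0_norm a + c0_norm b.
Proof.
apply sup_norm_le; intros n.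
eapply Rle_trans; [apply (norm_triangle (V := V)) |].
apply Rplus_le_compat; apply c0_norm_term.
Qed.

Lemma c0_norm_scal (k : K) a : c0_norm (scal k a) <= abs k * c0_norm a.
Proof.
apply sup_norm_le; intros n.
eapply Rle_trans; [apply (norm_scal (V := V)) |].
apply Rmult_le_compat_l; [apply abs_ge_0 | apply c0_norm_term].
Qed.

Lemma c0_norm_eq0 a : c0_norm a = 0 -> a = zero.
Proof.
intros H; apply seq_sub_eq; intros n; apply (norm_eq_zero (V := V)).
pose proof (c0_norm_term a n); pose proof (norm_ge_0 (proj1_sig a n)); lra.
Qed.

Lemma c0_complete (u : nat -> c0_ModuleSpace) :
  (forall eps : posreal, exists n0, forall m n,
     (n0 <= m)%nat -> (n0 <= n)%nat -> c0_norm (minus (u m) (u n)) < eps) ->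
  exists l, forall eps : posreal, exists n0, forall n,
     (n0 <= n)%nat -> c0_norm (minus (u n) l) < eps.
Proof.
intros HC.
assert (HL : forall j, exists l, forall eps : posreal, exists n0, forall n,
  (n0 <= n)%nat -> norm (minus (proj1_sig (u n) j) l) < eps).
{ intros j; apply (cauchy_seq_lim (fun n => proj1_sig (u n) j)).
  intros eps; destruct (HC eps) as [n0 Hn0]; exists n0; intros m n Hm Hn.
  eapply Rle_lt_trans; [| apply (Hn0 m n Hm Hn)].
  apply (c0_norm_term (minus (u m) (u n)) j). }
pose (l := fun j => proj1_sig (constructive_indefinite_description _ (HL j))).
assert (Hl : forall j, forall eps : posreal, exists n0, forall n,
  (n0 <= n)%nat -> norm (minus (proj1_sig (u n) j) (l j)) < eps) by
  (intros j; apply (proj2_sig (constructive_indefinite_description _ (HL j)))).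
assert (HB : forall eps : posreal, exists n0, forall n, (n0 <= n)%nat ->
  forall j, norm (minus (proj1_sig (u n) j) (l j)) <= eps).
{ intros eps; destruct (HC eps) as [n0 Hn0]; exists n0; intros n Hn j.
  apply (is_lim_seq_le
    (fun k => norm (minus (proj1_sig (u n) j) (proj1_sig (u (k + n0)%nat) j)))
    (fun _ => eps) (norm (minus (proj1_sig (u n) j) (l j))) eps).
  - intros k; left.
    apply Rle_lt_trans with (2 := Hn0 n (k + n0)%nat Hn ltac:(lia)).
    apply (c0_norm_term (minus (u n) (u (k + n0)%nat)) j).
  - apply (is_lim_seq_incr_n
      (fun k => norm (minus (proj1_sig (u n) j) (proj1_sig (u k) j))) n0).
    exact (is_lim_seq_norm_minus (V := V) (fun k => proj1_sig (u k) j) (l j)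
      (proj1_sig (u n) j) (Hl j)).
  - apply is_lim_seq_const. }
assert (HP : null_seq l).
{ apply lim_null_seq, is_lim_seq_spec; intros eps.
  assert (He : 0 < eps / 2) by (destruct eps; simpl; lra).
  destruct (HB (mkposreal _ He)) as [n0 Hn0].
  specialize (Hn0 n0 (le_n _)); simpl in Hn0.
  pose proof (null_seq_lim _ (proj2_sig (u n0))) as Hu.
  apply is_lim_seq_spec in Hu; destruct (Hu (mkposreal _ He)) as [j0 Hj0].
  simpl in Hj0; exists j0; intros j Hj.
  specialize (Hn0 j); specialize (Hj0 j Hj); revert Hj0.
  rewrite !Rminus_0_r, !Rabs_pos_eq by apply norm_ge_0; intros Hj0.
  pose proof (Rle_trans _ _ _
    (norm_triangle_inv (V := V) (proj1_sig (u n0) j) (l j)) Hn0) as K1.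
  revert K1; unfold Rabs; destruct Rcase_abs; lra. }
exists (exist _ l HP); intros eps.
assert (He : 0 < eps / 2) by (destruct eps; simpl; lra).
destruct (HB (mkposreal _ He)) as [n0 Hn0]; exists n0; intros n Hn.
apply Rle_lt_trans with (eps / 2); [| destruct eps; simpl; lra].
apply sup_norm_le; intros j; apply (Hn0 n Hn j).
Qed.

Definition c0_space : CompleteNormedModule K :=
  banach_of_norm c0_ModuleSpace c0_norm
    c0_norm_plus c0_norm_scal c0_norm_eq0 c0_complete.

End C0.

Record contraction {K : AbsRing} (V W : CompleteNormedModule K) : Type := {
  cmap :> V -> W;
  cmap_linear : is_linear cmap;
  cmap_le : forall x, norm (cmap x) <= norm x
}.

Arguments cmap {K V W} _ _.
Arguments cmap_linear {K V W} _.
Arguments cmap_le {K V W} _ _.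

Lemma contraction_eq {K : AbsRing} {V W : CompleteNormedModule K}
  (f g : contraction V W) : (forall x, f x = g x) -> f = g.
Proof.
destruct f as [f Hf Hf'], g as [g Hg Hg']; simpl; intros H.
assert (f = g) by (apply functional_extensionality; easy).
subst g; f_equal; apply proof_irrelevance.
Qed.

Definition make_contraction {K : AbsRing} {V W : CompleteNormedModule K}
  (f : V -> W)
  (f_plus : forall x y : V, f (plus x y) = plus (f x) (f y))
  (f_scal : forall (k : K) (x : V), f (scal k x) = scal k (f x))
  (f_le : forall x, norm (f x) <= norm x) : contraction V W :=
  {| cmap := f;
     cmap_linear := @Build_is_linear K V W f f_plus f_scal
       (ex_intro _ 1 (conj Rlt_0_1
         (fun x => Rle_trans _ _ _ (f_le x) (Req_le _ _ (eq_sym (Rmult_1_l _))))));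
     cmap_le := f_le |}.

Definition contraction_id {K : AbsRing} (V : CompleteNormedModule K) :
  contraction V V :=
  make_contraction (fun x => x) (fun _ _ => eq_refl) (fun _ _ => eq_refl)
    (fun _ => Rle_refl _).

Section ContractionComp.

Context {K : AbsRing} {U V W : CompleteNormedModule K}.
Variables (g : contraction V W) (f : contraction U V).

Lemma contraction_comp_plus (x y : U) : g (f (plus x y)) = plus (g (f x)) (g (f y)).
Proof.
rewrite <- (linear_plus _ (cmap_linear g)); f_equal.
apply (linear_plus _ (cmap_linear f)).
Qed.

Lemma contraction_comp_scal (k : K) (x : U) : g (f (scal k x)) = scal k (g (f x)).
Proof.
rewrite <- (linear_scal _ (cmap_linear g)); f_equal.
apply (linear_scal _ (cmap_linear f)).
Qed.

Lemma contraction_comp_le (x : U) : norm (g (f x)) <= norm x.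
Proof. eapply Rle_trans; apply cmap_le. Qed.

Definition contraction_comp : contraction U W :=
  make_contraction (fun x => g (f x))
    contraction_comp_plus contraction_comp_scal contraction_comp_le.

End ContractionComp.

Section BoxplusMap.

Context {K : AbsRing} (p : Rbar) (hp : Rbar_le 1 p).
Context {V V' W W' : CompleteNormedModule K}.
Variables (f : contraction V V') (g : contraction W W').

Definition boxplus_fun (x : boxplus p hp V W) : boxplus p hp V' W' :=
  (f (fst x), g (snd x)).

Lemma boxplus_fun_plus (x y : boxplus p hp V W) :
  boxplus_fun (plus x y) = plus (boxplus_fun x) (boxplus_fun y).
Proof.
apply injective_projections.
- apply (linear_plus _ (cmap_linear f)).
- apply (linear_plus _ (cmap_linear g)).
Qed.

Lemma boxplus_fun_scal (k : K) (x : boxplus p hp V W) :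
  boxplus_fun (scal k x) = scal k (boxplus_fun x).
Proof.
apply injective_projections.
- apply (linear_scal _ (cmap_linear f)).
- apply (linear_scal _ (cmap_linear g)).
Qed.

Lemma boxplus_fun_le (x : boxplus p hp V W) : norm (boxplus_fun x) <= norm x.
Proof.
apply pair_norm_mono; [exact hp | |]; split;
  try apply norm_ge_0; apply cmap_le.
Qed.

Definition boxplus_map : contraction (boxplus p hp V W) (boxplus p hp V' W') :=
  make_contraction boxplus_fun boxplus_fun_plus boxplus_fun_scal boxplus_fun_le.

End BoxplusMap.

Definition seq_cons {T : Type} (a : T) (s : nat -> T) (n : nat) : T :=
  match n with O => a | S m => s m end.

Section GammaLp.

Context {K : AbsRing} (V : CompleteNormedModule K) (p : R) (hp : 1 <= p).

Lemma p_summable_cons (a : V) (s : nat -> V) :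
  p_summable p s -> p_summable p (seq_cons a s).
Proof.
intros H; apply (ex_series_incr_1 (K := R_AbsRing)); exact H.
Qed.

Definition lp_gamma_fun (x : boxplus (Finite p) hp V (lp_space V p hp)) :
  lp_space V p hp :=
  exist _ (seq_cons (fst x) (proj1_sig (snd x)))
    (p_summable_cons _ _ (proj2_sig (snd x))).

Lemma lp_gamma_plus x y :
  lp_gamma_fun (plus x y) = plus (lp_gamma_fun x) (lp_gamma_fun y).
Proof. apply seq_sub_eq; intros [| n]; reflexivity. Qed.

Lemma lp_gamma_scal (k : K) x : lp_gamma_fun (scal k x) = scal k (lp_gamma_fun x).
Proof. apply seq_sub_eq; intros [| n]; reflexivity. Qed.

Lemma lp_gamma_le x : norm (lp_gamma_fun x) <= norm x.
Proof.
destruct x as [a [s Hs]]; right.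
change (Rpow (Series (fun n => Rpow (norm (seq_cons a s n)) p)) (/ p) =
  Rpow (Rpow (norm a) p +
    Rpow (Rpow (Series (fun n => Rpow (norm (s n)) p)) (/ p)) p) (/ p)).
f_equal; rewrite Series_incr_1 by (apply p_summable_cons; exact Hs).
f_equal; symmetry; apply Rpow_inv_Rpow; [lra |].
apply lp_series_ge0; easy.
Qed.

Definition lp_gamma : contraction (boxplus (Finite p) hp V (lp_space V p hp))
                                  (lp_space V p hp) :=
  make_contraction lp_gamma_fun lp_gamma_plus lp_gamma_scal lp_gamma_le.

End GammaLp.

Section GammaC0.

Context {K : AbsRing} (V : CompleteNormedModule K).

Lemma null_seq_cons (a : V) (s : nat -> V) : null_seq s -> null_seq (seq_cons a s).
Proof.
intros H; apply lim_null_seq, is_lim_seq_incr_1.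
exact (null_seq_lim _ H).
Qed.

Definition c0_gamma_fun (x : boxplus p_infty I V (c0_space V)) : c0_space V :=
  exist _ (seq_cons (fst x) (proj1_sig (snd x)))
    (null_seq_cons _ _ (proj2_sig (snd x))).

Lemma c0_gamma_plus x y :
  c0_gamma_fun (plus x y) = plus (c0_gamma_fun x) (c0_gamma_fun y).
Proof. apply seq_sub_eq; intros [| n]; reflexivity. Qed.

Lemma c0_gamma_scal (k : K) x : c0_gamma_fun (scal k x) = scal k (c0_gamma_fun x).
Proof. apply seq_sub_eq; intros [| n]; reflexivity. Qed.

Lemma c0_gamma_le x : norm (c0_gamma_fun x) <= norm x.
Proof.
apply sup_norm_le; intros [| n]; simpl.
- apply (boxplus_norm_ge p_infty I V (c0_space V) x).
- eapply Rle_trans; [apply c0_norm_term |].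
  apply (boxplus_norm_ge p_infty I V (c0_space V) x).
Qed.

Definition c0_gamma : contraction (boxplus p_infty I V (c0_space V)) (c0_space V) :=
  make_contraction c0_gamma_fun c0_gamma_plus c0_gamma_scal c0_gamma_le.

End GammaC0.

Record Category : Type := {
  Ob : Type;
  Hom : Ob -> Ob -> Type;
  idm : forall X, Hom X X;
  comp : forall X Y Z, Hom Y Z -> Hom X Y -> Hom X Z;
  comp_id_l : forall X Y (f : Hom X Y), comp X Y Y (idm Y) f = f;
  comp_id_r : forall X Y (f : Hom X Y), comp X X Y f (idm X) = f;
  comp_assoc : forall W X Y Z (h : Hom Y Z) (g : Hom X Y) (f : Hom W X),
    comp W Y Z h (comp W X Y g f) = comp W X Z (comp X Y Z h g) f
}.

(* Existence and uniqueness of [f] in one formula; equality of maps is Leibniz. *)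
Definition is_initial (C : Category) (X : Ob C) : Prop :=
  forall Y : Ob C, exists f : Hom C X Y, forall g : Hom C X Y, g = f.

Inductive ground_field : Type := Real | Complex.

Definition scalars (F : ground_field) : AbsRing :=
  match F with Real => R_AbsRing | Complex => C_AbsRing end.

Definition scalar_space (F : ground_field) : CompleteNormedModule (scalars F) :=
  match F with
  | Real => R_CompleteNormedModule
  | Complex => C_CompleteNormedModule
  end.

Section CategoryD.

Variables (F : ground_field) (p : Rbar) (hp : Rbar_le 1 p).

Record D_ob : Type := {
  D_space : CompleteNormedModule (scalars F);
  D_map : contraction (boxplus p hp (scalar_space F) D_space) D_space
}.

Record D_hom (X Y : D_ob) : Type := {
  D_fun : contraction (D_space X) (D_space Y);
  D_comm : contraction_comp D_fun (D_map X) =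
    contraction_comp (D_map Y)
      (boxplus_map p hp (contraction_id (scalar_space F)) D_fun)
}.

Arguments D_fun {X Y} _.
Arguments D_comm {X Y} _.

Lemma D_hom_eq X Y (f g : D_hom X Y) : (forall x, D_fun f x = D_fun g x) -> f = g.
Proof.
destruct f as [f Hf], g as [g Hg]; simpl; intros H.
apply contraction_eq in H; subst g; f_equal; apply proof_irrelevance.
Qed.

Lemma D_comm_apply X Y (f : D_hom X Y) (a : scalar_space F) (v : D_space X) :
  D_fun f (D_map X (a, v)) = D_map Y (a, D_fun f v).
Proof.
exact (f_equal
  (fun h : contraction (boxplus p hp (scalar_space F) (D_space X)) (D_space Y) =>
     h (a, v)) (D_comm f)).
Qed.

Definition D_id (X : D_ob) : D_hom X X.
Proof.
exists (contraction_id (D_space X)).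
apply contraction_eq; intros [a v]; reflexivity.
Defined.

Definition D_comp (X Y Z : D_ob) (g : D_hom Y Z) (f : D_hom X Y) : D_hom X Z.
Proof.
exists (contraction_comp (D_fun g) (D_fun f)).
apply contraction_eq; intros [a v].
transitivity (D_fun g (D_map Y (a, D_fun f v))).
- simpl; f_equal; apply D_comm_apply.
- apply D_comm_apply.
Defined.

Definition category_D : Category.
Proof.
refine {| Ob := D_ob; Hom := D_hom; idm := D_id; comp := D_comp |};
  intros; apply D_hom_eq; reflexivity.
Defined.

End CategoryD.

Definition lp_object (F : ground_field) (p : R) (hp : 1 <= p) :
  Ob (category_D F (Finite p) hp) :=
  Build_D_ob F (Finite p) hp
    (lp_space (scalar_space F) p hp) (lp_gamma (scalar_space F) p hp).

Definition c0_object (F : ground_field) : Ob (category_D F p_infty I) :=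
  Build_D_ob F p_infty I
    (c0_space (scalar_space F)) (c0_gamma (scalar_space F)).

(* Main.v *)
(** The map [gamma] is an isometric isomorphism; write [tail] for the second
component of its inverse [u].  Given [delta], a map [f] commutes with the
structure maps iff [f x = delta (fst (u x), f (tail x))].  Since
[delta (a, _)] does not increase distances, two maps obtained by unfolding this
equation [n] times differ at [x] by at most their difference at [tail^n x].
Contractions are bounded by the norm and [tail^n x] tends to [0], so the
iterates starting from the zero map are Cauchy at each point, their limit is a
solution, and any two contractive solutions agree. *)

Require Import Defs.
From Stdlib Require Import Reals Lra Lia.
From Coquelicot Require Import Coquelicot.

Open Scope R_scope.

(** * Convergence and distances under contractions *)

Lemma filterlim_norm_minus {K : AbsRing} {V : NormedModule K} (u : nat -> V) (l : V) :
  (forall eps : posreal, exists n0, forall n,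
     (n0 <= n)%nat -> norm (minus (u n) l) < eps) ->
  filterlim u eventually (locally l).
Proof.
intros H; apply (filterlim_locally_ball_norm (U := V)).
intros eps; destruct (H eps) as [n0 Hn0]; exists n0; exact Hn0.
Qed.

Lemma contraction_filterlim {K : AbsRing} {V W : CompleteNormedModule K}
  (f : contraction V W) (x : nat -> V) (l : V) :
  filterlim x eventually (locally l) ->
  filterlim (fun n => f (x n)) eventually (locally (f l)).
Proof.
intros H; apply (filterlim_comp _ _ _ x f _ (locally l) _ H).
apply (linear_cont (U := V) (V := W) f l (cmap_linear f)).
Qed.

Lemma contraction_minus {K : AbsRing} {V W : CompleteNormedModule K}
  (f : contraction V W) (x y : V) : f (minus x y) = minus (f x) (f y).
Proof.
transitivity (plus (f x) (f (opp y))).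
- apply (linear_plus _ (cmap_linear f)).
- apply (f_equal (plus (f x))), (linear_opp _ y (cmap_linear f)).
Qed.

(** The difference is [(0, v - w)], and for every [p] the norm of a pair is at most the sum of the
    norms of its components. *)
Lemma boxplus_norm_minus_snd {K : AbsRing} (p : Rbar) (hp : Rbar_le 1 p)
  {A V : CompleteNormedModule K} (a : A) (v w : V) :
  norm (minus ((a, v) : boxplus p hp A V) ((a, w) : boxplus p hp A V)) <=
  norm (minus v w).
Proof.
eapply Rle_trans; [apply (boxplus_norm_le_sum p hp A V) |].
change (norm (minus a a) + norm (minus v w) <= norm (minus v w)).
assert (H : norm (minus a a) = 0).
{ etransitivity; [apply f_equal, (minus_eq_zero (G := A)) |].
  apply (norm_zero (V := A)). }
lra.
Qed.

Lemma contraction_pair_minus_le {K : AbsRing} {p : Rbar} {hp : Rbar_le 1 p}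
  {A V W : CompleteNormedModule K} (f : contraction (boxplus p hp A V) W)
  (a : A) (v w : V) :
  norm (minus (f (a, v)) (f (a, w))) <= norm (minus v w).
Proof.
rewrite <- (contraction_minus f (a, v) (a, w)).
eapply Rle_trans; [apply cmap_le | apply boxplus_norm_minus_snd].
Qed.

Lemma filterlim_boxplus_snd {K : AbsRing} (p : Rbar) (hp : Rbar_le 1 p)
  {A V : CompleteNormedModule K} (a : A) (v : nat -> V) (l : V) :
  filterlim v eventually (locally l) ->
  filterlim (fun n => (a, v n) : boxplus p hp A V) eventually
    (locally ((a, l) : boxplus p hp A V)).
Proof.
intros H; apply (filterlim_norm_minus (V := boxplus p hp A V)); intros eps.
destruct (proj1 (filterlim_locally_ball_norm (U := V) v l) H eps) as [n0 Hn0].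
exists n0; intros n Hn; apply Rle_lt_trans with (2 := Hn0 n Hn).
apply boxplus_norm_minus_snd.
Qed.

(** * The unfolding equation: existence and uniqueness of a contractive solution *)

Section UniversalMap.

Context {K : AbsRing} {p : Rbar} {hp : Rbar_le 1 p} {A E W : CompleteNormedModule K}.
Variables (gamma : contraction (boxplus p hp A E) E) (u : E -> boxplus p hp A E).
Hypothesis gammaK : forall y, u (gamma y) = y.
Hypothesis uK : forall x, gamma (u x) = x.
Hypothesis u_le : forall x, norm (u x) <= norm x.

Definition tail (x : E) : E := snd (u x).

Hypothesis tail_lim :
  forall x, is_lim_seq (fun n => norm (Nat.iter n tail x)) 0.

Variable delta : contraction (boxplus p hp A W) W.

(** The two-sided inverse of an additive map is additive: both sides have the same image under
    [gamma]. *)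
Lemma u_plus x y : u (plus x y) = plus (u x) (u y).
Proof.
rewrite <- (gammaK (plus (u x) (u y))).
f_equal; rewrite (linear_plus _ (cmap_linear gamma)), !uK; reflexivity.
Qed.

Lemma u_scal k x : u (scal k x) = scal k (u x).
Proof.
rewrite <- (gammaK (scal k (u x))).
f_equal; rewrite (linear_scal _ (cmap_linear gamma)), !uK; reflexivity.
Qed.

Definition unfold_step (f : E -> W) (x : E) : W := delta (fst (u x), f (tail x)).

Definition approx (n : nat) : E -> W := Nat.iter n unfold_step (fun _ => zero).

Lemma approx_S n x : approx (S n) x = delta (fst (u x), approx n (tail x)).
Proof. reflexivity. Qed.

Lemma approx_plus n x y : approx n (plus x y) = plus (approx n x) (approx n y).
Proof.
revert x y; induction n as [| n IH]; intros x y.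
- symmetry; apply (plus_zero_r (G := W)).
- rewrite !approx_S, <- (linear_plus _ (cmap_linear delta)).
  unfold tail; rewrite u_plus; f_equal; apply injective_projections; [easy |].
  apply IH.
Qed.

Lemma approx_scal n k x : approx n (scal k x) = scal k (approx n x).
Proof.
revert x; induction n as [| n IH]; intros x.
- symmetry; apply (scal_zero_r (V := W)).
- rewrite !approx_S, <- (linear_scal _ (cmap_linear delta)).
  unfold tail; rewrite u_scal; f_equal; apply injective_projections; [easy |].
  apply IH.
Qed.

(** The bound survives each unfolding because [delta] is a contraction, [pair_norm] is monotone and
    [u] does not increase norms. *)
Lemma approx_le n x : norm (approx n x) <= norm x.
Proof.
revert x; induction n as [| n IH]; intros x.
- eapply Rle_trans; [right; apply (norm_zero (V := W)) | apply norm_ge_0].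
- rewrite approx_S; eapply Rle_trans; [apply cmap_le |].
  eapply Rle_trans; [| apply u_le].
  apply pair_norm_mono; [exact hp | |]; split; try apply norm_ge_0; [apply Rle_refl |].
  apply IH.
Qed.

(** The starting maps are arbitrary, so the estimate serves twice: with approximants for
    convergence, with two solutions for uniqueness. *)
Lemma iter_unfold_dist (f g : E -> W) n x :
  norm (minus (Nat.iter n unfold_step f x) (Nat.iter n unfold_step g x)) <=
  norm (minus (f (Nat.iter n tail x)) (g (Nat.iter n tail x))).
Proof.
revert x; induction n as [| n IH]; intros x; [apply Rle_refl |].
rewrite (Nat.iter_succ_r n _ tail).
eapply Rle_trans; [apply contraction_pair_minus_le | apply IH].
Qed.

Lemma approx_cauchy x (eps : posreal) : exists n0, forall m n,
  (n0 <= m)%nat -> (n0 <= n)%nat -> norm (minus (approx m x) (approx n x)) < eps.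
Proof.
pose proof (tail_lim x) as Ht; apply is_lim_seq_spec in Ht.
assert (He : 0 < eps / 2) by (destruct eps; simpl; lra).
destruct (Ht (mkposreal _ He)) as [n0 Hn0]; specialize (Hn0 n0 (le_n _)).
simpl in Hn0; rewrite Rminus_0_r, Rabs_pos_eq in Hn0 by apply norm_ge_0.
exists n0; intros m n Hm Hn.
(* Beyond index [n0], every approximant is [n0] unfoldings of an earlier one. The distance is thus
   controlled at the single point [tail^n0 x], where each of the two earlier approximants has norm
   below [eps / 2]. *)
assert (split_iter : forall k, (n0 <= k)%nat ->
  approx k x = Nat.iter n0 unfold_step (approx (k - n0)) x).
{ intros k Hk; unfold approx; rewrite <- Nat.iter_add.
  replace (n0 + (k - n0))%nat with k by lia; easy. }
rewrite (split_iter m Hm), (split_iter n Hn).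
eapply Rle_lt_trans; [apply iter_unfold_dist |].
eapply Rle_lt_trans; [apply (norm_triangle (V := W)) |].
rewrite (norm_opp (V := W)).
pose proof (approx_le (m - n0) (Nat.iter n0 tail x)).
pose proof (approx_le (n - n0) (Nat.iter n0 tail x)); lra.
Qed.

Definition limit_map (x : E) : W :=
  proj1_sig (ClassicalEpsilon.constructive_indefinite_description _
    (cauchy_seq_lim (fun n => approx n x) (approx_cauchy x))).

Lemma limit_map_lim x :
  filterlim (fun n => approx n x) eventually (locally (limit_map x)).
Proof.
apply (filterlim_norm_minus (V := W)).
exact (proj2_sig (ClassicalEpsilon.constructive_indefinite_description _
  (cauchy_seq_lim (fun n => approx n x) (approx_cauchy x)))).
Qed.

(** [limit_map] is chosen separately at each point; uniqueness of limits is what lets its algebraic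
    properties pass from the approximants. *)
Lemma limit_map_unique x (l : W) :
  filterlim (fun n => approx n x) eventually (locally l) -> limit_map x = l.
Proof.
intros H.
exact (filterlim_locally_unique (V := W) _ _ _ (limit_map_lim x) H).
Qed.

Lemma limit_map_plus x y : limit_map (plus x y) = plus (limit_map x) (limit_map y).
Proof.
apply limit_map_unique.
apply filterlim_ext with (fun n => plus (approx n x) (approx n y)).
- intros n; symmetry; apply approx_plus.
- eapply filterlim_comp_2; [apply limit_map_lim | apply limit_map_lim |].
  apply (filterlim_plus (V := W)).
Qed.

Lemma limit_map_scal k x : limit_map (scal k x) = scal k (limit_map x).
Proof.
apply limit_map_unique.
apply filterlim_ext with (fun n => scal k (approx n x)).
- intros n; symmetry; apply approx_scal.
- exact (filterlim_comp _ _ _ _ _ _ _ _ (limit_map_lim x)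
    (filterlim_scal_r (V := W) k _)).
Qed.

Lemma limit_map_le x : norm (limit_map x) <= norm x.
Proof.
apply (is_lim_seq_le (fun n => norm (approx n x)) (fun _ => norm x)
  (norm (limit_map x)) (norm x)).
- intros n; apply approx_le.
- exact (filterlim_comp _ _ _ _ _ _ _ _ (limit_map_lim x)
    (filterlim_norm (V := W) _)).
- apply is_lim_seq_const.
Qed.

(** Both sides are limits of [approx (S n) x]: the left as a subsequence, the right by continuity of
    [delta]. *)
Lemma limit_map_unfold x : limit_map x = delta (fst (u x), limit_map (tail x)).
Proof.
apply (filterlim_locally_unique (V := W) (F := eventually)
  (fun n => approx (S n) x)).
- exact (filterlim_comp _ _ _ S (fun n => approx n x) _ _ _
    (eventually_subseq S (fun n => Nat.lt_succ_diag_r (S n))) (limit_map_lim x)).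
- exact (contraction_filterlim delta (fun n => (fst (u x), approx n (tail x))) _
    (filterlim_boxplus_snd p hp _ _ _ (limit_map_lim (tail x)))).
Qed.

Definition limit_contraction : contraction E W :=
  make_contraction limit_map limit_map_plus limit_map_scal limit_map_le.

Lemma limit_contraction_gamma y :
  limit_contraction (gamma y) = delta (fst y, limit_contraction (snd y)).
Proof.
transitivity (delta (fst (u (gamma y)), limit_map (tail (gamma y)))).
- apply limit_map_unfold.
- unfold tail; rewrite gammaK; reflexivity.
Qed.

(** Both maps are fixed by [unfold_step], so for every [n] their distance at [x] is at most twice
    the norm of [tail^n x]. *)
Lemma contraction_unfold_unique (f g : contraction E W) :
  (forall y, f (gamma y) = delta (fst y, f (snd y))) ->
  (forall y, g (gamma y) = delta (fst y, g (snd y))) ->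
  forall x, f x = g x.
Proof.
intros Hf Hg x.
assert (fixed : forall h : contraction E W,
  (forall y, h (gamma y) = delta (fst y, h (snd y))) ->
  forall n z, Nat.iter n unfold_step h z = h z).
{ intros h Hh; induction n as [| n IH]; intros z; [easy |].
  change (unfold_step (Nat.iter n unfold_step h) z = h z).
  (* Only the [z] on the right-hand side becomes [gamma (u z)], which leaves [Hh] at [u z]. *)
  unfold unfold_step; rewrite IH; rewrite <- (uK z) at 3; symmetry; apply Hh. }
assert (H : norm (minus (f x) (g x)) <= 2 * 0).
{ apply (is_lim_seq_le (fun _ => norm (minus (f x) (g x)))
    (fun n => 2 * norm (Nat.iter n tail x))
    (norm (minus (f x) (g x))) (2 * 0)).
  - intros n; rewrite <- (fixed f Hf n x), <- (fixed g Hg n x).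
    eapply Rle_trans; [apply iter_unfold_dist |].
    eapply Rle_trans; [apply (norm_triangle (V := W)) |].
    rewrite (norm_opp (V := W)).
    pose proof (cmap_le f (Nat.iter n tail x)).
    pose proof (cmap_le g (Nat.iter n tail x)); lra.
  - apply is_lim_seq_const.
  - apply (is_lim_seq_scal_l _ 2 0), tail_lim. }
pose proof (norm_ge_0 (minus (f x) (g x))).
apply (plus_reg_r (G := W) (opp (g x))).
transitivity (zero : W); [| symmetry; apply (plus_opp_r (G := W))].
apply (norm_eq_zero (V := W) (minus (f x) (g x))); lra.
Qed.

End UniversalMap.

(** Isolates what the two sequence spaces share: evaluated at pairs, the commuting square of [D_hom]
    is the unfolding equation, so initiality reduces to checks on [u] and its tails. *)
Lemma initial_of_vanishing_tails (F : ground_field) (p : Rbar) (hp : Rbar_le 1 p)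
  (X : Ob (category_D F p hp))
  (u : D_space F p hp X -> boxplus p hp (scalar_space F) (D_space F p hp X)) :
  (forall y, u (D_map F p hp X y) = y) ->
  (forall x, D_map F p hp X (u x) = x) ->
  (forall x, norm (u x) <= norm x) ->
  (forall x, is_lim_seq (fun n => norm (Nat.iter n (tail u) x)) 0) ->
  is_initial (category_D F p hp) X.
Proof.
intros gammaK uK u_le tail_lim Y.
pose (f := limit_contraction (D_map F p hp X) u gammaK uK u_le tail_lim
  (D_map F p hp Y)).
assert (Hf : contraction_comp f (D_map F p hp X) =
  contraction_comp (D_map F p hp Y)
    (boxplus_map p hp (contraction_id (scalar_space F)) f)).
{ apply contraction_eq; intros y; apply limit_contraction_gamma. }
exists (Build_D_hom F p hp X Y f Hf); intros g.
apply D_hom_eq.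
apply (contraction_unfold_unique (D_map F p hp X) u uK tail_lim (D_map F p hp Y)).
- intros [a v]; apply (D_comm_apply F p hp X Y g).
- intros y; apply limit_contraction_gamma.
Qed.

(** * Shifted sequences and the inverse of [gamma] on [ell^p] and [c_0] *)

Lemma iter_behead {T : Type} {P : (nat -> T) -> Prop} (f : {a | P a} -> {a | P a}) :
  (forall a k, proj1_sig (f a) k = proj1_sig a (S k)) ->
  forall n a k, proj1_sig (Nat.iter n f a) k = proj1_sig a (n + k)%nat.
Proof.
intros Hf n a; induction n as [| n IH]; intros k; [easy |].
simpl; rewrite Hf, IH; f_equal; lia.
Qed.

Lemma Series_tail_lim (a : nat -> R) : ex_series a ->
  is_lim_seq (fun n => Series (fun k => a (n + k)%nat)) 0.
Proof.
(* [sum_n a n] includes the term [a n], so the remainder that complements it starts at [S n]. *)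
intros Ha; apply is_lim_seq_incr_1.
apply is_lim_seq_ext with (fun n => Series a - sum_n a n).
- intros n; rewrite (Series_incr_n a (S n)) by (easy || lia).
  rewrite sum_n_Reals; simpl pred; ring.
- replace 0 with (Series a - Series a) by ring.
  apply is_lim_seq_minus'; [apply is_lim_seq_const |].
  exact (Series_correct a Ha).
Qed.

Section SequenceInverse.

Context {K : AbsRing} (V : CompleteNormedModule K).

Lemma p_summable_behead (p : R) (s : nat -> V) :
  p_summable p s -> p_summable p (fun n => s (S n)).
Proof.
intros H; exact (proj1 (ex_series_incr_1 (fun n => Rpow (norm (s n)) p)) H).
Qed.

Definition lp_uncons (p : R) (hp : 1 <= p) (x : lp_space V p hp) :
  boxplus (Finite p) hp V (lp_space V p hp) :=
  (proj1_sig x 0%nat, exist _ _ (p_summable_behead p _ (proj2_sig x))).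

Lemma lp_gamma_uncons p hp x : lp_gamma V p hp (lp_uncons p hp x) = x.
Proof. apply seq_sub_eq; intros [| n]; reflexivity. Qed.

Lemma lp_uncons_gamma p hp y : lp_uncons p hp (lp_gamma V p hp y) = y.
Proof.
apply injective_projections; [easy |].
apply seq_sub_eq; reflexivity.
Qed.

(** Equality holds: the [p]-th power undoes the inner root, and the first term rejoins the
    series. *)
Lemma lp_uncons_le p hp x : norm (lp_uncons p hp x) <= norm x.
Proof.
destruct x as [s Hs]; right.
change (Rpow (Rpow (norm (s 0%nat)) p +
    Rpow (Rpow (Series (fun n => Rpow (norm (s (S n))) p)) (/ p)) p) (/ p) =
  Rpow (Series (fun n => Rpow (norm (s n)) p)) (/ p)).
f_equal; rewrite (Series_incr_1 (fun n => Rpow (norm (s n)) p)) by exact Hs.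
f_equal; apply Rpow_inv_Rpow; [lra |].
apply (lp_series_ge0 p (fun n => s (S n))), p_summable_behead; exact Hs.
Qed.

(** The norm of the [n]-th tail is the [p]-th root of a remainder of a convergent series. *)
Lemma lp_tail_lim p hp (x : lp_space V p hp) :
  is_lim_seq (fun n => norm (Nat.iter n (tail (lp_uncons p hp)) x)) 0.
Proof.
(* Writing the limit as [Rpow 0 (/ p)] allows the root to be taken after the limit of the
   remainders. *)
rewrite <- (Rpow_0 (/ p)).
apply is_lim_seq_ext with
  (fun n => Rpow (Series (fun k => Rpow (norm (proj1_sig x (n + k)%nat)) p)) (/ p)).
- intros n.
  change (norm (Nat.iter n (tail (lp_uncons p hp)) x)) with
    (lp_norm p (proj1_sig (Nat.iter n (tail (lp_uncons p hp)) x))).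
  unfold lp_norm; f_equal; apply Series_ext; intros k; do 2 f_equal; symmetry.
  exact (iter_behead (P := p_summable p) (tail (lp_uncons p hp))
    (fun _ _ => eq_refl) n x k).
- apply is_lim_seq_Rpow; [apply Rinv_0_lt_compat; lra | |].
  + intros n; apply (lp_series_ge0 p (fun k => proj1_sig x (n + k)%nat)).
    apply (ex_series_incr_n (fun k => Rpow (norm (proj1_sig x k)) p) n).
    apply (proj2_sig x).
  + apply (Series_tail_lim (fun k => Rpow (norm (proj1_sig x k)) p)).
    apply (proj2_sig x).
Qed.

Lemma null_seq_behead (s : nat -> V) : null_seq s -> null_seq (fun n => s (S n)).
Proof.
intros H; apply lim_null_seq.
apply (is_lim_seq_incr_1 (fun n => norm (s n)) 0), null_seq_lim; exact H.
Qed.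

Definition c0_uncons (x : c0_space V) : boxplus p_infty I V (c0_space V) :=
  (proj1_sig x 0%nat, exist _ _ (null_seq_behead _ (proj2_sig x))).

Lemma c0_gamma_uncons x : c0_gamma V (c0_uncons x) = x.
Proof. apply seq_sub_eq; intros [| n]; reflexivity. Qed.

Lemma c0_uncons_gamma y : c0_uncons (c0_gamma V y) = y.
Proof.
apply injective_projections; [easy |].
apply seq_sub_eq; reflexivity.
Qed.

Lemma c0_uncons_le x : norm (c0_uncons x) <= norm x.
Proof.
apply Rmax_lub.
- apply (c0_norm_term V x).
- apply sup_norm_le; intros n; apply (c0_norm_term V x).
Qed.

(** The norm of the [n]-th tail is the supremum of the terms from index [n] on, which vanishes in
    the limit because [x] is null. For bounded sequences this fails, as constant ones show. *)
Lemma c0_tail_lim (x : c0_space V) :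
  is_lim_seq (fun n => norm (Nat.iter n (tail c0_uncons) x)) 0.
Proof.
apply is_lim_seq_spec; intros eps.
assert (He : 0 < eps / 2) by (destruct eps; simpl; lra).
pose proof (null_seq_lim _ (proj2_sig x)) as Hx.
apply is_lim_seq_spec in Hx; destruct (Hx (mkposreal _ He)) as [n0 Hn0].
exists n0; intros n Hn; rewrite Rminus_0_r, Rabs_pos_eq by apply norm_ge_0.
(* A strict bound on all terms gives only a weak bound on their supremum, hence the margin
   [eps / 2]. *)
apply Rle_lt_trans with (eps / 2); [| destruct eps; simpl; lra].
apply sup_norm_le; intros k.
replace (proj1_sig _ k) with (proj1_sig x (n + k)%nat)
  by (symmetry; exact (iter_behead (P := null_seq) (tail c0_uncons)
        (fun _ _ => eq_refl) n x k)).
specialize (Hn0 (n + k)%nat ltac:(lia)); simpl in Hn0.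
rewrite Rminus_0_r, Rabs_pos_eq in Hn0 by apply norm_ge_0; lra.
Qed.

End SequenceInverse.

Theorem proposition2p11 (F : ground_field) :
  (forall (p : R) (hp : 1 <= p), is_initial (category_D F (Finite p) hp) (lp_object F p hp)) /\
  is_initial (category_D F p_infty I) (c0_object F).
Proof.
split; [intros p hp |].
- exact (initial_of_vanishing_tails F (Finite p) hp (lp_object F p hp)
    (lp_uncons (scalar_space F) p hp) (lp_uncons_gamma _ p hp)
    (lp_gamma_uncons _ p hp) (lp_uncons_le _ p hp) (lp_tail_lim _ p hp)).
- exact (initial_of_vanishing_tails F p_infty I (c0_object F)
    (c0_uncons (scalar_space F)) (c0_uncons_gamma _) (c0_gamma_uncons _)
    (c0_uncons_le _) (c0_tail_lim _)).
Qed.
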